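(* For $n\ge 2$, the reversal map $R:a_1a_2\cdots a_n\mapsto a_na_{n-1}\cdots a_1$, restricted to the set of full permutations of $[n]$, carries indecomposable permutations to decomposable permutations and decomposable permutations to indecomposable permutations.
   Context: $[n]=\{1,\dots,n\}$; permutations are in one-line notation. The permutation matrix of $\pi=a_1\cdots a_n$ has a $1$ in row $n+1-a_j$, column $j$. Bootstrap percolation: a cell is mutable if it contains $0$ and at least two of its orthogonal neighbours (N, S, E, W) contain $1$; mutable cells are changed to $1$ one at a time until none remain (final configuration independent of the order). $\pi$ is full if the final configuration is the all-ones matrix. A permutation $\pi$ of $[n]$ is indecomposable if there is no $1\le k<n$ with $\pi(\{1,\dots,k\})=\{1,\dots,k\}$, and decomposable otherwise. *)

(* Defs.v *)
From mathcomp Require Import all_boot all_fingroup all_algebra.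

Set Implicit Arguments.
Unset Strict Implicit.
Unset Printing Implicit Defensive.

(* Positions and values of a permutation, and the rows and columns of a
   configuration, are numbered from 0: the index i : 'I_n stands for the
   element i + 1 of {1, ..., n}.  The one-line notation of s : 'S_n is
   s 0, s 1, ..., s (n - 1). *)

(* In a configuration, [true] stands for the entry 1 and [false] for 0. *)
Definition config (n : nat) := 'M[bool]_n.

(* A cell is a pair (row, column). *)
Definition adjacent (n : nat) (c d : 'I_n * 'I_n) : bool :=
  (c.1 == d.1) && ((c.2.+1 == d.2 :> nat) || (d.2.+1 == c.2 :> nat))
  || (c.2 == d.2) && ((c.1.+1 == d.1 :> nat) || (d.1.+1 == c.1 :> nat)).

Definition mutable (n : nat) (A : config n) (c : 'I_n * 'I_n) : bool :=
  ~~ A c.1 c.2 && (1 < #|[set d | adjacent c d && A d.1 d.2]|).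

Definition infect (n : nat) (A : config n) (c : 'I_n * 'I_n) : config n :=
  (\matrix_(i, j) (((i, j) == c) || A i j))%R.

Definition percolation_step (n : nat) : rel 'M[bool]_n :=
  fun A B => [exists c, mutable A c && (B == infect A c)].

(* B is the outcome of a maximal sequence of steps starting from A. *)
Definition final_config (n : nat) (A B : config n) : bool :=
  connect (@percolation_step n) A B && [forall c, ~~ mutable B c].

(* Row n + 1 - a_j in 1-based numbering is row [rev_ord (s j)]; this is not
   [perm_mx s]. *)
Definition permutation_config (n : nat) (s : 'S_n) : config n :=
  (\matrix_(i, j) (i == rev_ord (s j)))%R.

Definition full (n : nat) (s : 'S_n) : bool :=
  final_config (permutation_config s) (const_mx true).

(* {1, ..., k} is the set of indices i with i < k. *)
Definition decomposable (n : nat) (s : 'S_n) : bool :=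
  [exists k : 'I_n, (0 < k) &&
    (s @: [set i : 'I_n | i < k] == [set i : 'I_n | i < k])].

Definition indecomposable (n : nat) (s : 'S_n) : bool := ~~ decomposable s.

(* Permutations compose from left to right: (s * t) j = t (s j), so that
   [reversal s j = s (rev_ord j)]. *)
Definition reversal (n : nat) (s : 'S_n) : 'S_n :=
  (perm (@rev_ord_inj n) * s)%g.

(* Main.v *)
Require Import Defs.
From mathcomp Require Import all_boot all_fingroup all_algebra.
From mathcomp Require Import zify.

(* Call [a, b) x [c, d) a block of s when s maps the positions in [a, b) onto
   the values in [c, d).  Two blocks that overlap or touch, both in positions
   and in values, have a block as their union.  If neither s nor its reversal
   is decomposable, this union is never the whole square, so the union of all
   proper blocks is closed under percolation: two infected neighbours of a cell
   lie in two such blocks, whose union contains the cell.  It contains the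
   initial configuration but not the corner of position 0 and value 0, hence s
   is not full. *)

Set Implicit Arguments.
Unset Strict Implicit.
Unset Printing Implicit Defensive.

Section Blocks.

Variable n : nat.
Implicit Types (s : 'S_n) (A B : config n).

Definition block s a b c d :=
  [/\ a < b <= n, c < d <= n & forall j : 'I_n, (a <= j < b) = (c <= s j < d)].

(** The four inequalities leave no gap, so each hull of two intervals is exactly their union. *)
Lemma block_union s a b c d a' b' c' d' :
    block s a b c d -> block s a' b' c' d' ->
    a <= b' -> a' <= b -> c <= d' -> c' <= d ->
  block s (minn a a') (maxn b b') (minn c c') (maxn d d').
Proof.
move=> [ab cd H] [ab' cd' H'] *; split; [lia | lia |] => j.
by have := H j; have := H' j; lia.
Qed.

Lemma block_full_values s a b : block s a b 0 n -> a = 0 /\ b = n.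
Proof.
move=> [ab n0 H]; have lt0 : 0 < n by lia.
have ltn1 : n.-1 < n by lia.
have := H (Ordinal lt0); have := H (Ordinal ltn1).
have := ltn_ord (s (Ordinal lt0)); have := ltn_ord (s (Ordinal ltn1)).
by move=> /=; lia.
Qed.

Lemma block_inverse s a b c d : block s a b c d -> block s^-1%g c d a b.
Proof. by move=> [ab cd H]; split=> // v; rewrite H permKV. Qed.

Lemma block_prefix_decomposable s b d :
  block s 0 b 0 d -> b < n -> decomposable s.
Proof.
move=> [b0 d0 H] bn; apply/existsP; exists (Ordinal bn) => /=.
apply/andP; split; first by lia.
have im : s @: [set i : 'I_n | i < b] = [set i : 'I_n | i < d].
  apply/setP=> v; rewrite -[v](permKV s) mem_imset; last exact: perm_inj.
  by rewrite !inE; have := H ((s^-1)%g v); lia.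
have cardE : #|[set i : 'I_n | i < d]| = #|[set i : 'I_n | i < b]|.
  by rewrite -im card_imset //; exact: perm_inj.
(* Initial segments are nested, so having the same cardinality makes them equal. *)
rewrite im; case: (leqP b d) => [bd | /ltnW db].
  rewrite eq_sym eqEcard cardE leqnn andbT.
  by apply/subsetP=> i; rewrite !inE; lia.
by rewrite eqEcard cardE leqnn andbT; apply/subsetP=> i; rewrite !inE; lia.
Qed.

Lemma reversalE s j : reversal s j = s (rev_ord j).
Proof. by rewrite permM permE. Qed.

(** The reversal sends the last [b] positions onto the values in [c, n), hence the first [n - b]
    positions onto those below [c]. *)
Lemma block_antiprefix_decomposable s b c :
  block s 0 b c n -> b < n -> decomposable (reversal s).
Proof.
move=> [b0 cn H] bn.
have c0 : 0 < c.
  rewrite lt0n; apply/eqP=> c0; subst c.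
  by have [] := block_full_values (And3 b0 cn H); lia.
apply: (@block_prefix_decomposable _ (n - b) c); last by lia.
split; [lia | lia |] => j; rewrite reversalE.
have := H (rev_ord j); have := ltn_ord (s (rev_ord j)); have := ltn_ord j.
by move=> /=; lia.
Qed.

(** Let the first block start at position 0. If it reaches the lowest or the highest value, it is a
    prefix of [s] or gives one of the reversal; otherwise the second block takes all values and so
    is not proper. *)
Lemma covering_blocks_decomposable s a b c d a' b' c' d' :
    block s a b c d -> block s a' b' c' d' ->
    b - a < n -> b' - a' < n ->
    minn a a' = 0 -> minn c c' = 0 -> maxn d d' = n ->
  decomposable s || decomposable (reversal s).
Proof.
wlog a0 : a b c d a' b' c' d' / a = 0 => [wl blk blk' lt lt' mina minc maxd|].
  have [a0 | a'0] : a = 0 \/ a' = 0 by lia.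
    exact: wl a0 blk blk' lt lt' mina minc maxd.
  by apply: wl a'0 blk' blk lt' lt _ _ _; lia.
subst a => blk blk' lt lt' _ minc maxd.
have [[_ cd _] [_ cd' _]] := (blk, blk').
have [c0 | [dn | [c'0 d'n]]] : c = 0 \/ d = n \/ (c' = 0 /\ d' = n) by lia.
- by subst c; rewrite (block_prefix_decomposable blk) //; lia.
- by subst d; rewrite (block_antiprefix_decomposable blk) ?orbT //; lia.
by subst c' d'; have [] := block_full_values blk'; lia.
Qed.

(* Row r of a configuration carries the value [rev_ord r]. *)
Definition in_proper_block s (p : 'I_n * 'I_n) :=
  exists a b c d,
    [/\ block s a b c d, b - a < n, a <= p.2 < b & c <= rev_ord p.1 < d].

Lemma in_proper_block_closed s (p q q' : 'I_n * 'I_n) :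
    ~~ (decomposable s || decomposable (reversal s)) ->
    adjacent p q -> adjacent p q' -> q != q' ->
    in_proper_block s q -> in_proper_block s q' ->
  in_proper_block s p.
Proof.
move=> indec; case: p q q' => [r j] [r1 j1] [r2 j2].
rewrite /adjacent xpair_eqE /= => adj adj' neq.
move=> [a [b [c [d [blk lt /= jI rI]]]]].
move=> [a' [b' [c' [d' [blk' lt' /= jI' rI']]]]].
have [[ab cd H] [ab' cd' H']] := (blk, blk').
have [? ? ?] := And3 (ltn_ord r) (ltn_ord r1) (ltn_ord r2).
rewrite -!val_eqE /= in adj adj' neq.
(* Opposite neighbours share a row or a column, so the two blocks share a point
   of the permutation. *)
have touch_pos : (a <= b') && (a' <= b).
  case: (eqVneq r1 r2) => [e | ne].
    have := H ((s^-1)%g (rev_ord r1)); have := H' ((s^-1)%g (rev_ord r1)).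
    by rewrite permKV /= e in rI *; lia.
  by rewrite -val_eqE /= in ne; lia.
have touch_val : (c <= d') && (c' <= d).
  case: (eqVneq j1 j2) => [e | ne].
    by have := H j1; have := H' j1; rewrite e in jI *; lia.
  by rewrite -val_eqE /= in ne; lia.
have [/andP[ab1 ab2] /andP[cd1 cd2]] := (touch_pos, touch_val).
have blkU := block_union blk blk' ab1 ab2 cd1 cd2.
(* Each coordinate of a cell lies weakly between those of two distinct neighbours, so the union
   contains the cell. *)
exists (minn a a'), (maxn b b'), (minn c c'), (maxn d d').
split=> //=; [|lia|lia].
rewrite ltnNge; apply: contra indec => big.
(* A union spanning all positions also spans all values, as the inverse shows. *)
have [ab0 abn] : minn a a' = 0 /\ maxn b b' = n by lia.
have blkV := block_inverse blkU; rewrite ab0 abn in blkV.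
have [cd0 cdn] := block_full_values blkV.
by apply: (covering_blocks_decomposable blk blk').
Qed.

Lemma percolation_in_proper_block s A B :
    ~~ (decomposable s || decomposable (reversal s)) ->
    connect (@percolation_step n) A B ->
    (forall p, A p.1 p.2 -> in_proper_block s p) ->
  forall p, B p.1 p.2 -> in_proper_block s p.
Proof.
move=> indec /connectP[w]; elim: w A => [|C w IH] A /=; first by move=> _ ->.
move=> /andP[/existsP[c /andP[/andP[_ mut] /eqP->]] Cw lastB] inA.
apply: IH Cw lastB _ => p; rewrite mxE -surjective_pairing.
case: eqP => [-> _ | _ /= Ap]; last exact: inA.
have [q [q' [+ + neq]]] := card_gt1P mut; rewrite !inE.
move=> /andP[cq Aq] /andP[cq' Aq'].
exact: in_proper_block_closed indec cq cq' neq (inA _ Aq) (inA _ Aq').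
Qed.

Lemma permutation_in_proper_block s p :
  1 < n -> permutation_config s p.1 p.2 -> in_proper_block s p.
Proof.
move=> n1; rewrite mxE => /eqP rE.
(* A single point is a 1 x 1 block, proper since [1 < n]. *)
exists p.2, p.2.+1, (s p.2), (s p.2).+1.
rewrite rE rev_ordK; split; [|lia|lia|lia].
split; rewrite ?ltn_ord ?andbT // => j.
by rewrite !ltnS -!eqn_leq !val_eqE (inj_eq perm_inj).
Qed.

Lemma corner_not_in_proper_block s (p : 'I_n * 'I_n) :
    ~~ decomposable s -> p.2 = 0 :> nat -> rev_ord p.1 = 0 :> nat ->
  ~ in_proper_block s p.
Proof.
move=> indec pos0 val0 [a [b [c [d [blk lt pI vI]]]]].
have [a0 c0] : a = 0 /\ c = 0 by lia.
subst a c; move/negP: indec; apply.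
by apply: block_prefix_decomposable blk _; lia.
Qed.

Lemma full_decomposable s :
  1 < n -> full s -> decomposable s || decomposable (reversal s).
Proof.
move=> n1 /andP[perc _]; apply: contraT => indec.
have n0 : 0 < n by lia.
pose o := Ordinal n0.
have corner : in_proper_block s (rev_ord o, o).
  apply: (percolation_in_proper_block indec perc); last by rewrite mxE.
  by move=> p; exact: permutation_in_proper_block.
move: indec; rewrite negb_or => /andP[indec _].
have := @corner_not_in_proper_block s (rev_ord o, o) indec.
by rewrite rev_ordK => /(_ erefl erefl).
Qed.

Lemma decomposable_prefix s :
  decomposable s -> exists k, 0 < k < n /\ forall j, (s j < k) = (j < k).
Proof.
move=> /existsP[k /andP[k0 /eqP im]]; exists k; split; first by rewrite k0 /=.
move=> j; have := mem_imset [set i : 'I_n | i < k] j (@perm_inj _ s).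
by rewrite im !inE.
Qed.

(** A cut of [s] puts its first value strictly below its last one; a cut of the reversal puts the
    last strictly below the first. *)
Lemma decomposable_reversal s :
  decomposable s -> ~~ decomposable (reversal s).
Proof.
move=> /decomposable_prefix[k [k0n Hk]]; apply/negP.
move=> /decomposable_prefix[l [l0n Hl]].
have n0 : 0 < n by lia.
pose o := Ordinal n0; pose m := rev_ord o.
have := (Hk o, Hk m, Hl o, Hl m).
rewrite !reversalE /m rev_ordK /= => -[[[]]]; lia.
Qed.

End Blocks.

Theorem theorem4p5 (n : nat) (hn : 2 <= n) (s : 'S_n) (hs : full s) :
  (indecomposable s -> decomposable (reversal s)) /\
  (decomposable s -> indecomposable (reversal s)).
Proof.
split; last exact: decomposable_reversal.
by move=> /negbTE indec; have := full_decomposable hn hs; rewrite indec.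
Qed.
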